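(* Let $G$ be a graph of order $n$ without isolated vertices. Then $col(G)\leq 2R'(G)$, with equality if and only if $G\cong K_k\bullet K_{1,n-k}$ for some $k\in\{1,\ldots,n\}$.
   Context: Graphs are finite, simple, undirected, with nonempty vertex set; the order of a graph is its number of vertices, and $d(u)$ denotes the degree of a vertex $u$ in $G$. $R'(G)=\sum_{uv\in E(G)}\frac{1}{\max\{d(u),d(v)\}}$. The coloring number $col(G)$ is the smallest integer $k$ for which there exists a linear ordering of the vertices of $G$ such that each vertex is preceded by fewer than $k$ of its neighbors. For integers $n\geq k\geq 1$, $K_k\bullet K_{1,n-k}$ denotes the graph of order $n$ obtained by identifying the center of the star $K_{1,n-k}$ with a vertex of the complete graph $K_k$ (that is, attaching $n-k$ pendant vertices to a single vertex of $K_k$). In particular, if $k\in\{1,2\}$, $K_k\bullet K_{1,n-k}\cong K_{1,n-1}$, and if $k=n$, $K_k\bullet K_{1,n-k}\cong K_n$. *)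

(* Defs.v *)
From mathcomp Require Import all_boot all_order all_algebra.
Set Implicit Arguments.
Unset Strict Implicit.
Unset Printing Implicit Defensive.

Import GRing.Theory Num.Theory.

(* A finite simple graph is a symmetric irreflexive adjacency relation [e] on a
   finType [T]; symmetry and irreflexivity are hypotheses of the theorem. *)

Section Graph.
Variables (T : finType) (e : rel T).

Definition deg (u : T) : nat := #|[set v | e u v]|.

(* An edge is the unordered pair {u, v}, so each edge counts once in [Rprime]. *)
Definition edges : {set {set T}} :=
  [set A : {set T} | [exists u, exists v, e u v && (A == [set u; v])]].

Definition Rprime : rat :=
  (\sum_(A in edges) ((\max_(u in A) deg u)%N%:R)^-1)%R.

(* A linear ordering of the vertices is an injective rank function [f] into
   'I_#|T|; [v] precedes [u] when [f v < f u]. *)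
Definition has_coloring_order (k : nat) : bool :=
  [exists f : {ffun T -> 'I_#|T|},
     injectiveb f && [forall u, #|[set v | e u v & f v < f u]| < k]].

Lemma has_coloring_order_ex : exists k, has_coloring_order k.
Proof.
exists #|T|.+1; apply/existsP; exists [ffun x => enum_rank x].
apply/andP; split.
  by apply/injectiveP => x y; rewrite !ffunE => /enum_rank_inj.
by apply/forallP => u; rewrite ltnS max_card.
Qed.

Definition coloring_number : nat := ex_minn has_coloring_order_ex.

End Graph.

Definition graph_iso (T1 T2 : finType) (e1 : rel T1) (e2 : rel T2) : Prop :=
  exists2 f : T1 -> T2, bijective f & {mono f : x y / e1 x y >-> e2 x y}.

(* K_k with n - k pendant vertices (the right summand) attached to its vertex 0;
   meaningful for 1 <= k <= n. *)
Definition clique_star (n k : nat) : rel ('I_k + 'I_(n - k)) :=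
  fun x y =>
    match x, y with
    | inl i, inl j => i != j
    | inl i, inr _ => i == 0 :> nat
    | inr _, inl j => j == 0 :> nat
    | inr _, inr _ => false
    end.

Lemma clique_star_sym n k : symmetric (@clique_star n k).
Proof. by case=> [i|i] [j|j] //=; rewrite eq_sym. Qed.

Lemma clique_star_irr n k : irreflexive (@clique_star n k).
Proof. by case=> [i|i] //=; rewrite eqxx. Qed.

Lemma card_clique_star n k : k <= n -> #|{: 'I_k + 'I_(n - k)}| = n.
Proof. by move=> le_kn; rewrite card_sum !card_ord subnKC. Qed.

(* Main.v *)
Require Import Defs.
From mathcomp Require Import all_boot all_order all_algebra.
From mathcomp Require Import zify.
Import GRing.Theory Num.Theory.

Set Implicit Arguments.
Unset Strict Implicit.
Unset Printing Implicit Defensive.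

(** Rank the vertices by decreasing degree, as u_0, u_1, ..., and charge every
    edge to its earlier end.  If [fwd u] counts the neighbours that come after
    [u], then R'(G) is the sum of the shares [fwd u / deg u], because the
    earlier end of an edge has the larger degree ([Rprime_fwd]).

    Write col(G) = k + 1.  No ordering has all its back-degrees below k, so in
    the ranking some vertex has k earlier neighbours; that vertex has rank and
    degree at least k, and therefore u_0, ..., u_k all have degree at least k.
    Only i vertices precede u_i, so for i < k its share is at least
    1 - i / deg u_i >= 1 - i / k.  With truncated subtraction the bound
    (k - i) / k holds at every rank, and these bounds add up to (k + 1) / 2
    whatever the order of the graph: hence k + 1 <= 2 R'(G), with equality
    exactly when every single share meets its bound ([twice_Rprime_leif]).

    When all shares are tight, u_0, ..., u_k form a clique, u_1, ..., u_(k-1)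
    have degree exactly k, and no vertex from u_k on has a later neighbour.  A
    vertex after u_k can then only be adjacent to u_0, and it is since it is not
    isolated ([hub_of_fwd_share]).  This is the graph obtained from K_(k+1) by
    hanging pendant vertices on u_0.  Conversely, in such a graph the ranking
    hub, clique, pendant vertices is by decreasing degree and makes all shares
    tight ([fwd_share_hub]), so 2 R'(G) = k + 1, while the clique forces
    col(G) >= k + 1. *)

(** * Orderings and the coloring number *)

Section ColoringNumber.
Variables (T : finType) (e : rel T).

(** The last vertex of the clique, in any ordering, is preceded by all the
    others. *)
Lemma clique_leq_coloring_number (Q : {set T}) :
  {in Q &, forall x y, x != y -> e x y} -> #|Q| <= coloring_number e.
Proof.
move=> Qclique; rewrite /coloring_number; case: ex_minnP => m.
case/existsP=> f /andP[/injectiveP f_inj /forallP f_lt] _.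
have [->|[u0 Qu0]] := set_0Vmem Q; first by rewrite cards0.
have [u Qu u_last] := @arg_maxnP _ u0 (mem Q) (fun x => f x : nat) Qu0.
apply: leq_trans (f_lt u); rewrite (cardsD1 u) [u \in Q]Qu ltnS.
apply/subset_leq_card/subsetP=> v; rewrite !inE => /andP[v'u Qv].
rewrite Qclique //= 1?eq_sym // ltn_neqAle; apply/andP; split; last exact: u_last.
by apply: contraNneq v'u => /val_inj/f_inj->.
Qed.

Lemma degeneracy_witness (r : T -> 'I_#|T|) k :
    injective r -> k < coloring_number e ->
  exists u, k <= #|[set v | e u v & r v < r u]|.
Proof.
rewrite /coloring_number => r_inj; case: ex_minnP => m _ m_min lt_km.
have: ~~ has_coloring_order e k.
  by apply: contraL lt_km => /m_min; rewrite -leqNgt.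
case/existsPn/(_ (finfun r))/nandP => [|/forallPn[u]].
  by case/injectiveP => x y; rewrite !ffunE => /r_inj.
rewrite -leqNgt => le_k; exists u; apply: leq_trans le_k _.
by apply/subset_leq_card/subsetP=> v; rewrite !inE !ffunE.
Qed.

Lemma degree_ranking_exists :
  exists2 r : T -> 'I_#|T|, injective r &
    forall u v, r u < r v -> deg e v <= deg e u.
Proof.
pose leT x y := deg e y <= deg e x; pose s := sort leT (enum T).
have mem_s x : x \in s by rewrite mem_sort mem_enum.
have ltrT x : index x s < #|T| by rewrite cardE -(size_sort leT) index_mem.
exists (fun x => Ordinal (ltrT x)) => [x y [] eq_xy | u v /= lt_uv].
  by rewrite -(nth_index x (mem_s x)) eq_xy nth_index.
have leT_trans : transitive leT by move=> y x z le1 le2; apply: leq_trans le2 le1.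
have s_sorted : sorted leT s by apply: sort_sorted => x y; apply: leq_total.
exact: (sorted_ltn_index leT_trans s_sorted u v (mem_s u) (mem_s v) lt_uv).
Qed.

End ColoringNumber.

(** * Ranked graphs *)

Lemma sum_sub_ord n k : k <= n -> (\sum_(i < n) (k - i)) * 2 = k * k.+1.
Proof.
elim: n k => [|n IHn] [|k] //; first by rewrite big_ord0.
  by move=> _; rewrite big1 // => i _; rewrite sub0n.
move=> le_kn; rewrite big_ord_recl subn0 mulnDl.
rewrite (eq_bigr (fun i : 'I_n => k - i)) => [|i _]; last by rewrite /= /bump; lia.
by rewrite IHn //; lia.
Qed.

(** This is [clique_star n K] in terms of ranks, clique first: no splitting of
    the vertices into two summands, and no dependence on [n]. *)
Definition hub_rel K i j := (i != j) && [|| (i < K) && (j < K), i == 0 | j == 0].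

Lemma hub_rel_sym K : symmetric (hub_rel K).
Proof.
move=> i j; rewrite /hub_rel eq_sym.
by rewrite [(i < _) && _]andbC [(i == 0) || _]orbC.
Qed.

Lemma hub_rel_irr K : irreflexive (hub_rel K).
Proof. by move=> i; rewrite /hub_rel eqxx. Qed.

Section Ranking.
Variables (T : finType) (e : rel T) (r : T -> 'I_#|T|).
Hypotheses (e_sym : symmetric e) (e_irr : irreflexive e) (r_inj : injective r).

Definition back u := #|[set v | e u v & r v < r u]|.
Definition fwd u := #|[set v | e u v & r u < r v]|.

Lemma card_rank_lt m : m <= #|T| -> #|[set v | r v < m]| = m.
Proof.
move=> le_mT; have r_bij : bijective r by apply: inj_card_bij; rewrite ?card_ord.
have -> : [set v | r v < m] = r @^-1: [set i : 'I__ | i < m].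
  by apply/setP=> v; rewrite !inE.
rewrite on_card_preimset; last exact: onW_bij.
rewrite -sum1_card (eq_bigl (fun i : 'I__ => i < m)) => [|i]; last by rewrite inE.
by rewrite -(big_ord_widen _ (fun=> 1)) // sum1_card card_ord.
Qed.

Lemma rank_inhabited m : m < #|T| -> exists u, r u = m :> nat.
Proof.
move=> lt_mT; have r_bij : bijective r by apply: inj_card_bij; rewrite ?card_ord.
by case: r_bij => g _ gK; exists (g (Ordinal lt_mT)); rewrite gK.
Qed.

Lemma sum_rank (F : nat -> nat) : \sum_u F (r u) = \sum_(i < #|T|) F i.
Proof.
have r_bij : bijective r by apply: inj_card_bij; rewrite ?card_ord.
by rewrite [RHS](reindex r) //; apply: onW_bij.
Qed.

Lemma deg_back_fwd u : deg e u = back u + fwd u.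
Proof.
rewrite /deg -(cardsID [set v | r v < r u]); congr (_ + _); apply: eq_card => v.
  by rewrite !inE.
rewrite !inE; case euv: (e u v); rewrite ?andbF // andbT -leqNgt leq_eqVlt.
case: eqP => // /val_inj/r_inj eq_uv; by rewrite eq_uv e_irr in euv.
Qed.

Lemma back_leq_rank u : back u <= r u.
Proof.
apply: leq_trans (eq_leq (card_rank_lt (ltnW (ltn_ord (r u))))).
by apply/subset_leq_card/subsetP=> v; rewrite !inE => /andP[].
Qed.

(** Each edge is the image of exactly one ordered pair going up in rank, and
    the maximum degree over the edge is the degree of the first member. *)
Lemma Rprime_fwd :
    (forall u v, r u < r v -> deg e v <= deg e u) ->
  Rprime e = (\sum_u (fwd u)%:R / (deg e u)%:R)%R.
Proof.
move=> r_deg.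
pose D := [set p : T * T | e p.1 p.2 & r p.1 < r p.2].
pose h (p : T * T) := [set p.1; p.2].
have edgesE : edges e = h @: D.
  apply/setP=> A; rewrite inE; apply/existsP/imsetP => [[u /existsP[v]]|[[u v]]].
    case/andP=> euv /eqP->; have [lt|lt|eq] := ltngtP (r u) (r v).
    - by exists (u, v); rewrite // inE euv.
    - by exists (v, u); [rewrite inE /= e_sym euv | rewrite /h setUC].
    by move/val_inj/r_inj: eq euv => ->; rewrite e_irr.
  rewrite inE /= => /andP[euv _] ->; exists u; apply/existsP; exists v.
  by rewrite euv eqxx.
have h_inj : {in D &, injective h}.
  move=> [u v] [x y]; rewrite !inE /= => /andP[_ lt_uv] /andP[_ lt_xy] /setP eqh.
  have := eqh v; have := eqh u; rewrite !inE !eqxx orbT /= => /esym/orP[]/eqP eq_u.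
    case/esym/orP=> /eqP eq_v; last by rewrite eq_u eq_v.
    by rewrite eq_u eq_v ltnn in lt_uv.
  case/esym/orP=> /eqP eq_v; rewrite eq_u eq_v in lt_uv.
    by rewrite ltnNge (ltnW lt_xy) in lt_uv.
  by rewrite ltnn in lt_uv.
rewrite /Rprime edgesE big_imset //=.
transitivity (\sum_(p in D) (deg e p.1)%:R^-1 : rat)%R.
  apply: eq_bigr => -[u v]; rewrite inE /= => /andP[_ lt_uv]; congr (_%:R^-1)%R.
  have u'v: u != v by apply: contraTneq lt_uv => ->; rewrite ltnn.
  rewrite big_setU1 /= ?inE // big_set1; exact/maxn_idPl/r_deg.
transitivity (\sum_u \sum_(v | e u v && (r u < r v)%N) (deg e u)%:R^-1 : rat)%R.
  by rewrite pair_big_dep; apply: eq_bigl => p; rewrite inE.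
apply: eq_bigr => u _; rewrite sumr_const mulr_natl; congr (_ *+ _)%R.
by apply: eq_card => v; rewrite !inE.
Qed.

(** At most [r u] neighbours precede [u], so [fwd u >= deg u - r u]; a degree
    of at least [k] makes the loss [r u / deg u] at most [r u / k].  From rank
    [k] on, the truncated left-hand side vanishes. *)
Lemma fwd_share_geq k u :
    (r u < k -> k <= deg e u) -> (k - r u) * deg e u <= fwd u * k.
Proof.
have := back_leq_rank u; rewrite deg_back_fwd.
by case: (ltnP (r u) k) => [lt_rk le_b /(_ isT) le_k | le_kr _ _]; nia.
Qed.

(** The bound is a sum of termwise bounds, hence tight exactly when all of
    them are; this is what turns the equality case into local information. *)
Lemma twice_Rprime_leif k :
    0 < k -> k <= #|T| -> (forall u, deg e u <> 0) ->
    (forall u v, r u < r v -> deg e v <= deg e u) ->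
    (forall u, r u < k -> k <= deg e u) ->
  (k.+1%:R <= 2 * Rprime e
     ?= iff [forall u, (k - r u) * deg e u == fwd u * k]%N :> rat)%R.
Proof.
move=> k_gt0 le_kT no_iso r_deg deg_ge_k.
have k0 : (k%:R != 0 :> rat)%R by rewrite pnatr_eq0 -lt0n.
have -> : (k.+1%:R = 2 * \sum_u (k - r u)%N%:R / k%:R :> rat)%R.
  rewrite -mulr_suml mulrA -natr_sum (sum_rank (fun i => k - i)) -natrM mulnC.
  by rewrite sum_sub_ord // natrM mulrAC divff ?mul1r.
rewrite (Rprime_fwd r_deg).
suff [le_S eq_S]: (\sum_u (k - r u)%N%:R / k%:R <= \sum_u (fwd u)%:R / (deg e u)%:R
     ?= iff [forall (u | true), (k - r u) * deg e u == fwd u * k]%N :> rat)%R.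
  by split; [rewrite ler_pM2l // | rewrite (inj_eq (mulfI _)) //].
apply: leif_sum => u _; have d_gt0 : 0 < deg e u by rewrite lt0n; apply/eqP.
split; first rewrite ler_pdivrMr ?ltr0n // mulrAC ler_pdivlMr ?ltr0n // -!natrM.
  by rewrite ler_nat (fwd_share_geq (deg_ge_k u)).
by rewrite eqr_div ?pnatr_eq0 -?lt0n // -!natrM eqr_nat.
Qed.

(** Tightness at ranks strictly between 0 and [k] forces both [deg u = k] and
    [back u = r u]; at rank [k] or more it forces [fwd u = 0].  At rank 0 it
    says nothing, which is why pendant vertices may hang there. *)
Lemma hub_of_fwd_share k :
    0 < k -> k < #|T| -> (forall u, deg e u <> 0) ->
    (forall u, r u <= k -> k <= deg e u) ->
    (forall u, (k - r u) * deg e u = fwd u * k) ->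
  forall u v, e u v = hub_rel k.+1 (r u) (r v).
Proof.
move=> k_gt0 lt_kT no_iso deg_ge_k share.
have fwd0 u v : k <= r u -> r u < r v -> e u v = false.
  move=> le_ku lt_uv; have /eqP := share u.
  rewrite (_ : k - r u = 0) ?mul0n; last by apply/eqP; rewrite subn_eq0.
  rewrite eq_sym muln_eq0 [k == 0]eqn0Ngt k_gt0 orbF cards_eq0 => /eqP/setP/(_ v).
  by rewrite !inE lt_uv andbT.
(* [u] has as many earlier neighbours as there are earlier ranks.  At rank [k]
   this uses [deg e u >= k], since there [share] only gives [fwd u = 0]. *)
have back_full u v : r u <= k -> r v < r u -> e u v.
  move=> le_uk lt_vu; have eq_b : back u = r u.
    have := share u; have := deg_ge_k u le_uk; have := back_leq_rank u.
    by rewrite deg_back_fwd; nia.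
  have sub : [set w | e u w & r w < r u] \subset [set w | r w < r u].
    by apply/subsetP=> w; rewrite !inE => /andP[].
  have /esym := (subset_leqif_card sub).2.
  rewrite -[#|[set w | e u w & _]|]/(back u) eq_b card_rank_lt 1?ltnW // eqxx.
  by move/subsetP/(_ v); rewrite !inE lt_vu andbT; apply.
have deg_k u : 0 < r u -> r u < k -> deg e u = k.
  move=> u_gt0 lt_uk; have := share u; have := deg_ge_k u (ltnW lt_uk).
  by have := back_leq_rank u; rewrite deg_back_fwd; nia.
(* The other vertices of the clique already exhaust the degree of [u]. *)
have no_far u v : 0 < r u -> r u < k -> k < r v -> e u v = false.
  move=> u_gt0 lt_uk lt_kv; pose A := [set w | r w < k.+1] :\ u.
  have cardA : #|A| = k.
    have := cardsD1 u [set w | r w < k.+1].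
    by rewrite inE ltnS (ltnW lt_uk) card_rank_lt // => -[].
  have sub : A \subset [set w | e u w].
    apply/subsetP=> w; rewrite !inE ltnS => /andP[w'u le_wk].
    have [lt|lt|/val_inj/r_inj eq] := ltngtP (r w) (r u).
    - by apply: back_full => //; apply: ltnW.
    - by rewrite e_sym back_full.
    by rewrite eq eqxx in w'u.
  have /esym := (subset_leqif_card sub).2.
  rewrite cardA -/(deg e u) deg_k // eqxx => /subsetP/(_ v).
  by rewrite !inE ltnS [_ <= k]leqNgt lt_kv andbF => /contraFF; apply.
move=> u v; wlog lt_uv : u v / r u < r v.
  move=> wlt; have [lt|lt|/val_inj/r_inj->] := ltngtP (r u) (r v).
  - exact: wlt.
  - by rewrite e_sym hub_rel_sym wlt.
  by rewrite e_irr hub_rel_irr.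
rewrite /hub_rel.
have -> /= : r u != r v :> nat by rewrite ltn_eqF.
have [le_vk | lt_kv] := leqP (r v) k.
  by rewrite e_sym back_full // !ltnS le_vk (leq_trans (ltnW lt_uv)).
have -> : (r v == 0 :> nat) = false by rewrite gtn_eqF // (leq_ltn_trans _ lt_uv).
rewrite [r v < _]ltnNge lt_kv andbF orbF /=.
(* A neighbour of [v] cannot follow [v], nor have rank at least [k], nor have
   its rank strictly between 0 and [k]. *)
have far_nbr w : e w v -> r w = 0 :> nat.
  move=> ewv; have [le_vw | lt_wv] := leqP (r v) (r w).
    move: le_vw; rewrite leq_eqVlt => /orP[/eqP/val_inj/r_inj eq | lt_vw].
      by rewrite eq e_irr in ewv.
    by rewrite e_sym fwd0 // ltnW in ewv.
  have [le_kw | lt_wk] := leqP k (r w); first by rewrite fwd0 in ewv.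
  by case: (posnP (r w)) => // w_gt0; rewrite no_far in ewv.
apply/idP/eqP => [/far_nbr // | u0].
have /set0Pn[w] : [set w | e v w] != set0.
  by rewrite -cards_eq0; apply/eqP/no_iso.
rewrite inE e_sym => ewv; suff -> : u = w by [].
by apply/r_inj/val_inj; rewrite /= u0 far_nbr.
Qed.

End Ranking.

(** * Cliques with pendant vertices at a hub *)

Section HubRanking.
Variables (T : finType) (e : rel T) (r : T -> 'I_#|T|) (k : nat).
Hypotheses (r_inj : injective r) (k_gt0 : 0 < k) (lt_kT : k < #|T|).
Hypothesis e_hub : forall u v, e u v = hub_rel k.+1 (r u) (r v).

Lemma deg_hub u :
  deg e u = if r u == 0 :> nat then #|T|.-1 else if r u <= k then k else 1.
Proof.
have rE (x y : T) : (r x == r y :> nat) = (x == y).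
  by apply/eqP/eqP=> [/val_inj/r_inj | ->].
have [u0 | u_gt0] := posnP (r u).
  have -> : #|T|.-1 = #|~: [set u]| by rewrite cardsC1.
  by apply: eq_card => v; rewrite !inE e_hub /hub_rel rE u0 /= orbT andbT eq_sym.
have [le_uk | lt_ku] := leqP (r u) k.
  have := cardsD1 u [set w | r w < k.+1].
  rewrite inE ltnS le_uk card_rank_lt // => -[->]; apply: eq_card => v.
  rewrite !inE e_hub /hub_rel rE eq_sym !ltnS le_uk eqn0Ngt u_gt0 /=.
  by rewrite orb_idr // => /eqP->.
have [w w0] := rank_inhabited r_inj (ltn_trans k_gt0 lt_kT).
rewrite -(cards1 w); apply: eq_card => v.
rewrite !inE e_hub /hub_rel -(rE v) w0 ltnS leqNgt lt_ku eqn0Ngt u_gt0 /=.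
by have [->|] := posnP (r v); rewrite ?andbF // gtn_eqF.
Qed.

(** The hub has no earlier neighbour, so its share is 1; a clique vertex of
    rank i has degree [k] and [k - i] later neighbours; pendant vertices have
    none. *)
Lemma fwd_share_hub u : (k - r u) * deg e u = fwd e r u * k.
Proof.
have [u0 | u_gt0] := posnP (r u).
  rewrite u0 subn0 mulnC (deg_back_fwd _ r_inj) => [|x]; last first.
    by rewrite e_hub hub_rel_irr.
  have := back_leq_rank e r_inj u; rewrite u0 leqn0 => /eqP-> //.
have [le_uk | lt_ku] := leqP (r u) k.
  rewrite deg_hub gtn_eqF // le_uk; congr (_ * _).
  have := cardsID [set w | r w < (r u).+1] [set w | r w < k.+1].
  rewrite card_rank_lt // (_ : _ :&: _ = [set w | r w < (r u).+1]); last first.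
    apply/setP=> w; rewrite !inE !ltnS andbC andb_idr // => le_wu.
    exact: leq_trans le_wu le_uk.
  rewrite card_rank_lt // => /eqP; rewrite addSn eqSS => /eqP <-.
  rewrite addKn; apply: eq_card => w; rewrite !inE e_hub /hub_rel -ltnNge !ltnS le_uk.
  have [lt_uw|] := ltnP (r u) (r w); last by rewrite andbF.
  rewrite (ltn_eqF lt_uw) (gtn_eqF u_gt0) (gtn_eqF (ltn_trans u_gt0 lt_uw)).
  by rewrite !orbF andbT.
rewrite (_ : k - r u = 0) ?mul0n; last by apply/eqP; rewrite subn_eq0 ltnW.
rewrite /fwd (_ : [set v | _ & _] = set0) ?cards0 //.
apply/setP=> v; rewrite !inE e_hub /hub_rel ltnS leqNgt lt_ku (gtn_eqF u_gt0) /=.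
by have [->|] := posnP (r v); rewrite ?andbF // ltn0 andbF.
Qed.

Lemma coloring_number_hub_geq : k < coloring_number e.
Proof.
rewrite -[k.+1](card_rank_lt r_inj lt_kT); apply: clique_leq_coloring_number.
move=> u v; rewrite !inE e_hub /hub_rel => -> -> /=; rewrite andbT.
by apply: contraNneq => /val_inj/r_inj->.
Qed.

Lemma twice_Rprime_hub : (2 * Rprime e = k.+1%:R :> rat)%R.
Proof.
have e_sym : symmetric e by move=> u v; rewrite !e_hub hub_rel_sym.
have e_irr : irreflexive e by move=> u; rewrite e_hub hub_rel_irr.
have no_iso u : deg e u <> 0.
  by rewrite deg_hub; case: eqP => _; [lia | case: ifP => _; lia].
have r_deg u v : r u < r v -> deg e v <= deg e u.
  move=> lt_uv; rewrite !deg_hub gtn_eqF ?(leq_ltn_trans _ lt_uv) //.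
  case: eqP => _; first by case: ifP => _; lia.
  have [le_vk | lt_kv] := leqP (r v) k; first by rewrite (leq_trans (ltnW lt_uv)).
  by case: ifP.
have deg_ge_k u : r u < k -> k <= deg e u.
  by move=> lt_uk; rewrite deg_hub (ltnW lt_uk); case: ifP => _; lia.
have [_] := twice_Rprime_leif e_sym e_irr r_inj k_gt0 (ltnW lt_kT) no_iso r_deg deg_ge_k.
have -> : [forall u, (k - r u) * deg e u == fwd e r u * k].
  by apply/forallP => u; rewrite fwd_share_hub.
by move/eqP.
Qed.

End HubRanking.

Lemma clique_star_unsplit n k : 0 < k -> forall x y : 'I_k + 'I_(n - k),
  clique_star x y = hub_rel k (unsplit x) (unsplit y).
Proof.
move=> k_gt0; rewrite /hub_rel => -[i|i] [j|j] /=.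
- by rewrite !ltn_ord /= andbT.
- rewrite [k + j < k]ltnNge leq_addr andbF [k + j == 0]gtn_eqF ?ltn_addr //.
  by rewrite orbF /= [i == k + j :> nat]ltn_eqF // ltn_addr.
- rewrite [k + i < k]ltnNge leq_addr [k + i == 0]gtn_eqF ?ltn_addr //=.
  by rewrite [k + i == j :> nat]gtn_eqF // ltn_addr.
rewrite ![k + _ < k]ltnNge !leq_addr /=.
by rewrite ![k + _ == 0]gtn_eqF ?ltn_addr // andbF.
Qed.

Lemma iso_clique_starP (T : finType) (e : rel T) k : 0 < k -> k <= #|T| ->
  graph_iso e (@clique_star #|T| k) <->
  exists2 r : T -> 'I_#|T|, injective r & forall u v, e u v = hub_rel k (r u) (r v).
Proof.
move=> k_gt0 le_kT; split=> [[f f_bij f_iso] | [r r_inj r_hub]].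
  exists (fun u => cast_ord (subnKC le_kT) (unsplit (f u))) => [u v | u v].
    by move/cast_ord_inj/(can_inj unsplitK)/(bij_inj f_bij).
  by rewrite -f_iso clique_star_unsplit.
exists (fun u => split (cast_ord (esym (subnKC le_kT)) (r u))) => [|u v].
  apply: inj_card_bij; last by rewrite card_clique_star.
  by move=> u v /(can_inj splitK)/cast_ord_inj/r_inj.
by rewrite clique_star_unsplit // !splitK r_hub.
Qed.

(** A clique on one vertex with pendant vertices is a star, which is as well a
    clique on two vertices with the other leaves pendant. *)
Lemma hub_rel_star i j : hub_rel 1 i j = hub_rel 2 i j.
Proof. by case: i j => [|[|i]] [|[|j]]. Qed.

(** * The bound and its equality case *)

Theorem theorem1p4 (n : nat) (T : finType) (e : rel T)
    (e_sym : symmetric e) (e_irr : irreflexive e)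
    (T_nonempty : 0 < #|T|) (order_n : #|T| = n)
    (no_isolated : forall u : T, deg e u <> 0) :
  ((coloring_number e)%:R <= 2 * Rprime e :> rat)%R /\
  (((coloring_number e)%:R = 2 * Rprime e :> rat)%R <->
   exists k : nat, [/\ 1 <= k, k <= n & graph_iso e (@clique_star n k)]).
Proof.
subst n.
have [u0 _] := card_gt0P T_nonempty.
have /set0Pn[v0] : [set v | e u0 v] != set0.
  by rewrite -cards_eq0; apply/eqP/no_isolated.
rewrite inE => e_uv0.
have u'v0 : u0 != v0 by apply: contraTneq e_uv0 => ->; rewrite e_irr.
have T_gt1 : 1 < #|T| by rewrite -[2]/(true.+1) -u'v0 -cards2 max_card.
have col_gt1 : 1 < coloring_number e.
  rewrite -[2]/(true.+1) -u'v0 -cards2; apply: clique_leq_coloring_number.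
  by move=> x y /set2P[]-> /set2P[]->; rewrite ?eqxx // e_sym.
have [k k_gt0 col_k] : exists2 k, 0 < k & coloring_number e = k.+1.
  by exists (coloring_number e).-1; case: (coloring_number e) col_gt1 => [|[]].
have [r r_inj r_deg] := degree_ranking_exists e.
have [u le_k_back] : exists u, k <= back e r u.
  by apply: degeneracy_witness; rewrite // col_k.
have le_ku : k <= r u := leq_trans le_k_back (back_leq_rank e r_inj u).
have lt_kT : k < #|T| := leq_ltn_trans le_ku (ltn_ord _).
(* The ranking is by decreasing degree, and [u] has rank and degree at least
   [k], so every vertex of rank at most [k] has degree at least [k]. *)
have deg_ge_k v : r v <= k -> k <= deg e v.
  move=> le_vk; have le_k_degu : k <= deg e u.
    by rewrite (deg_back_fwd e_irr r_inj) (leq_trans le_k_back) ?leq_addr.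
  have := leq_trans le_vk le_ku; rewrite leq_eqVlt => /orP[/eqP/val_inj/r_inj-> //|].
  by move/r_deg; apply: leq_trans.
have [le_col eq_col] := twice_Rprime_leif e_sym e_irr r_inj k_gt0 (ltnW lt_kT)
  no_isolated r_deg (fun v lt_vk => deg_ge_k v (ltnW lt_vk)).
rewrite col_k; split=> //; split=> [/eqP | [m [m_gt0 le_mT]]].
  rewrite eq_col => /forallP share; exists k.+1; split=> //.
  apply/iso_clique_starP => //; exists r => //.
  by apply: hub_of_fwd_share => // v; apply/eqP.
case/(iso_clique_starP _ m_gt0 le_mT) => s s_inj s_hub_m.
(* [q.+1] is the order of the clique, once a star is read as having a clique
   on two vertices. *)
have [q [q_gt0 lt_qT s_hub]] : exists q, [/\ 0 < q, q < #|T| &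
    forall x y, e x y = hub_rel q.+1 (s x) (s y)].
  case: m m_gt0 le_mT s_hub_m => [|[|q]] // _ le_mT s_hub_m; last by exists q.+1.
  by exists 1; split=> // x y; rewrite s_hub_m hub_rel_star.
have eq_q := twice_Rprime_hub s_inj q_gt0 lt_qT s_hub.
apply: Order.POrderTheory.le_anti; rewrite le_col eq_q ler_nat -col_k.
exact: coloring_number_hub_geq s_inj lt_qT s_hub.
Qed.
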